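(* Let $I$ be an interval on the real line, let $\psi : I \to \mathbb{R}$ be a continuous function and let $\mathcal{C}>0$ be a parameter such that the following two conditions hold: for all real numbers $\delta_1,\delta_2$ with $\delta_1 \neq 0$, $$|\{(x,y)\in I^2 : x-y=\delta_1,\ \psi(x)-\psi(y)=\delta_2\}| \ll_{\mathcal{C}} 1,$$ and for all real numbers $n_1,n_2$, $$|\{(x,y)\in I^2 : x+y=n_1,\ \psi(x)+\psi(y)=n_2\}| \ll_{\mathcal{C}} 1.$$ Let $A$ be a finite subset of $I$ with $|A| \geq 2$, and let $s \geq 3$ be a natural number. Then $$E_{s,3}(A) \ll_{\mathcal{C}} |A|^{3s-6+2^{-s+3}} \log|A|.$$
   Context: For $\mathbf{n}=(n_1,n_2)\in\mathbb{R}^2$, $r_s(\mathbf{n})$ is the number of $(x_1,\dots,x_s)\in A^s$ with $\sum_{i=1}^s x_i = n_1$ and $\sum_{i=1}^s \psi(x_i) = n_2$. Then $E_{s,3}(A) = \sum_{\mathbf{n}} r_s(\mathbf{n})^3$, the sum being over the (finitely many) $\mathbf{n}\in\mathbb{R}^2$ with $r_s(\mathbf{n})>0$. The notation $X \ll_{\mathcal{C}} Y$ means $|X| \leq K|Y|$ for some constant $K>0$ depending only on $\mathcal{C}$ (after renaming the parameter, the two conditions on $I,\psi$ say that the stated cardinalities are at most $\mathcal{C}$). *)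

(* Defs.v *)
From HB Require Import structures.
From mathcomp Require Import all_boot all_order all_algebra finmap.
From mathcomp Require Import all_classical all_reals all_analysis.
Import Order.TTheory GRing.Theory Num.Theory.
Import numFieldNormedType.Exports.

Set Implicit Arguments.
Unset Strict Implicit.
Unset Printing Implicit Defensive.

Local Open Scope classical_set_scope.
Local Open Scope ring_scope.

(* [fset_set S] is empty when [S] is infinite, hence the first conjunct. *)
Definition card_at_most (R : realType) (T : choiceType) (S : set T) (C : R)
    : Prop :=
  finite_set S /\ (#|` fset_set S|)%:R <= C.

(* A function [I -> R] is represented by a total [psi : R -> R] of which only
   the values on [I] are used. *)
Definition difference_pairs (R : realType) (I : set R) (psi : R -> R)
    (d1 d2 : R) : set (R * R) :=
  [set p | [/\ I p.1, I p.2, p.1 - p.2 = d1 & psi p.1 - psi p.2 = d2]].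

Definition sum_pairs (R : realType) (I : set R) (psi : R -> R)
    (n1 n2 : R) : set (R * R) :=
  [set p | [/\ I p.1, I p.2, p.1 + p.2 = n1 & psi p.1 + psi p.2 = n2]].

Definition rep (R : realType) (psi : R -> R) (A : {fset R}) (s : nat)
    (n : R * R) : nat :=
  #|[pred x : {ffun 'I_s -> A} |
      (\sum_i val (x i) == n.1) && (\sum_i psi (val (x i)) == n.2)]|.

Definition rep_support (R : realType) (psi : R -> R) (A : {fset R}) (s : nat)
    : set (R * R) :=
  [set n | (0 < rep psi A s n)%N].

(* The sum over a classical set is 0 by convention when infinitely many terms
   are nonzero; this lemma shows that the convention is never triggered in
   [energy3]. *)
Lemma finite_rep_support (R : realType) (psi : R -> R) (A : {fset R})
    (s : nat) : finite_set (rep_support psi A s).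
Proof.
pose f (x : {ffun 'I_s -> A}) : R * R :=
  (\sum_i val (x i), \sum_i psi (val (x i))).
apply: (@sub_finite_set _ _ (f @` setT)).
  move=> [n1 n2]; rewrite /rep_support /= => /card_gt0P[x].
  by rewrite inE /= => /andP[/eqP <- /eqP <-]; exists x.
exact/finite_image/finite_finset.
Qed.

Definition energy3 (R : realType) (psi : R -> R) (A : {fset R}) (s : nat) : R :=
  \sum_(n \in rep_support psi A s) ((rep psi A s n)%:R ^+ 3 : R).

(* Main.v *)
Require Import Defs.
From mathcomp Require Import all_boot all_order all_algebra finmap.
From mathcomp Require Import all_classical all_reals all_analysis.
From mathcomp Require Import zify ring lra.
Import Order.TTheory GRing.Theory Num.Theory.
Import numFieldNormedType.Exports.

Set Implicit Arguments.
Unset Strict Implicit.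
Unset Printing Implicit Defensive.

(** Write [N] for the cardinal of [A], [r_s] for [rep psi A s] and [E_s] for the
sum of [r_s ^ 2]. The graph of [psi], translated by a point [q], is a curve;
[r_{s+1} u] is at most the total weight of the curves through [u] when the
translate by [q] carries the weight [r_s q], because a representation of [u]
amounts to a point [a] of [A] and a representation of [u - (a, psi a)]. The
hypothesis on differences says that two translates meet in boundedly many points
and, read the other way, that two points lie on boundedly many translates. So
this is an incidence problem of Szemeredi-Trotter type with weights, and its
answer is the weak-type bound ([rich_points_rep])
  #{u : r_{s+1} u >= t} <= K * N ^ s * E_s / t ^ 3   for all t > 0,
with [K] depending only on the bound for the cardinals.

Summing this over dyadic values of [t] gives the second moment
  E_{s+1} <= T * N ^ (s+1) + 8 * K * N ^ s * E_s / T   for every T > 0,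
the first term coming from the [u] with [r_{s+1} u < T]. The best [T] turns a
bound [D] for [E_s] into a bound of order [N ^ (s+1) * sqrt (D / N)], so the
exponent of [N] in excess of [2 s - 3] is halved at each step; since the constant
enters under a square root, it stays bounded as [s] grows ([energy2_le]). For the
third moment the bound for a dyadic layer is the same for all layers,
[8 K N ^ s E_s], and only about [log N] layers matter: between the above [T] and the
trivial bound [r_{s+1} u <= C N ^ (s-1)] there is a factor at most of order [N]
([energy3_le]). This is where the single logarithm comes from, with no loss
depending on [s]. The induction starts from [r_2 <= C], the hypothesis on sums.

The incidence bound is proved by cutting the plane. Only the abscissas of the
points matter, the columns. In each column the curves are totally ordered by
height, and by the intermediate value theorem the order of two given curves changes
a bounded number of times along the columns ([rich_points_translates]). What
remains is combinatorial. Give each curve a mass and cut the stack of curves in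
every column into strips of mass [W]; cut each strip further whenever the mass
that entered it exceeds [W]. Each cell then meets curves of mass [O(W)], and by
averaging over the offset of the strips the number of cells is
[O(V ^ 2 / W ^ 2)], where [V >= W] is the total mass ([level_cutting]). In a cell the
Cauchy-Schwarz inequality and the bound for common curves limit the number of
incidences ([incidence_cauchy]), and summing over the cells bounds the number of
rich points ([rich_points_by_cutting]). *)

(** * Cutting a moving stack of curves into cells *)

(** Hermite's identity. Averaged over the offset [j], the index of the strip of
width [W] that contains [x] is an exact linear function of [x]. *)
Lemma sum_divn_shift (W x : nat) : 0 < W -> \sum_(j < W) (x + j) %/ W = x.
Proof.
move=> W0; elim: x => [|x IH].
  by apply: big1 => j _; rewrite add0n divn_small.
have E : \sum_(j < W.+1) (x + j) %/ W = \sum_(j < W.+1) (x + j) %/ W by [].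
rewrite {1}big_ord_recl big_ord_recr /= IH addn0 divnDr // divnn W0 in E.
have {}E : \sum_(j < W) (x.+1 + j) %/ W + x %/ W = x + (x %/ W + 1).
  rewrite -E addnC; congr (_ + _); apply: eq_bigr => j _.
  by congr (_ %/ _); rewrite /bump /=; lia.
lia.
Qed.

(** A displacement by [D] crosses a strip boundary for at most [D] of the [W]
possible offsets. *)
Lemma sum_shift_neq (W x y D : nat) : 0 < W -> x <= y + D -> y <= x + D ->
  \sum_(j < W) ((x + j) %/ W != (y + j) %/ W) <= D.
Proof.
move=> W0.
wlog xy : x y / x <= y => [H|_ yD].
  case: (leqP x y) => [xy|/ltnW yx] h1 h2; first exact: H.
  by under eq_bigr do rewrite eq_sym; exact: H.
have : \sum_(j < W) ((x + j) %/ W + ((x + j) %/ W != (y + j) %/ W)) <=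
       \sum_(j < W) (y + j) %/ W.
  apply: leq_sum => j _.
  have : (x + j) %/ W <= (y + j) %/ W by apply: leq_div2r; rewrite leq_add2r.
  by case: eqP; lia.
rewrite big_split /= !sum_divn_shift //; lia.
Qed.

Section Cutting.
Variables (Q : finType) (v : Q -> nat) (M B W : nat) (lt : nat -> rel Q).
Hypothesis lt_irr : forall c, irreflexive (lt c).
Hypothesis lt_trans : forall c, transitive (lt c).
Hypothesis lt_total : forall c x y, x != y -> lt c x y || lt c y x.
Hypothesis lt_changes :
  forall x y, \sum_(c < M) (lt c x y != lt c.+1 x y) <= B.
Hypothesis W_gt0 : 0 < W.
Hypothesis v_leW : forall q, v q <= W.

Let V := \sum_q v q.
(* the mass lying strictly below [q] in column [c] *)
Let pos c q := \sum_(p | lt c p q) v p.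

Let pos_lt c p q : lt c p q -> pos c p + v p <= pos c q.
Proof.
move=> pq; rewrite /pos [leqRHS](bigD1 p) //= addnC leq_add2l.
rewrite [leqLHS]big_mkcond [leqRHS]big_mkcond /=; apply: leq_sum => r _.
case: ifP => // rp; rewrite (lt_trans rp pq) /=.
by case: eqP rp => // ->; rewrite lt_irr.
Qed.

Let pos_leV c q : pos c q <= V.
Proof. by rewrite /pos /V big_mkcond; apply: leq_sum => p _; case: ifP. Qed.

Let pos_step (l1 l2 : rel Q) q :
  \sum_(p | l1 p q) v p <=
  \sum_(p | l2 p q) v p + \sum_p v p * (l1 p q != l2 p q).
Proof.
rewrite big_mkcond [in X in _ <= X + _]big_mkcond -big_split /=.
by apply: leq_sum => p _; case: (l1 p q); case: (l2 p q) => //=; lia.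
Qed.

(* The total mass of the changes of strip, for the strips
   [(pos + j) %/ W = i]. A curve is displaced by at most the mass of the
   curves that change their order with it, whence the average over [j]. *)
Let moved j := \sum_(c < M) \sum_q
  v q * ((pos c q + j) %/ W != (pos c.+1 q + j) %/ W).

Let sum_moved : \sum_(j < W) moved j <= B * V ^ 2.
Proof.
rewrite exchange_big /=.
apply: (@leq_trans (\sum_(c < M) \sum_q
   v q * \sum_p v p * (lt c p q != lt c.+1 p q))).
  apply: leq_sum => c _; rewrite exchange_big /=; apply: leq_sum => q _.
  rewrite -big_distrr leq_mul2l; apply/orP; right.
  apply: sum_shift_neq => //; first exact: pos_step.
  under [X in _ + X]eq_bigr do rewrite eq_sym.
  exact: pos_step.
rewrite exchange_big /=.
rewrite expnS expn1 mulnCA /V big_distrl /=; apply: leq_sum => q _.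
rewrite -big_distrr leq_mul2l; apply/orP; right.
rewrite exchange_big big_distrr /=; apply: leq_sum => p _.
by rewrite -big_distrr /= mulnC leq_mul2r lt_changes orbT.
Qed.

Let good_offset : exists2 j, j < W & W * moved j <= B * V ^ 2.
Proof.
pose j0 : 'I_W := Ordinal W_gt0.
have [j _ jmin] := arg_minnP (fun j : 'I_W => moved j) (isT : xpredT j0).
exists j => //; apply: leq_trans sum_moved.
rewrite -{1}[W]card_ord -sum_nat_const; exact: leq_sum.
Qed.

(* The mass below the topmost curve of the window exceeds the mass below the
   lowest one by less than [W]; the topmost curve itself adds at most [W]. *)
Let window_mass (P : pred Q) c a :
  (forall q, P q -> a <= pos c q < a + W) -> \sum_(q | P q) v q <= 2 * W.
Proof.
move=> Pw; case: (pickP P) => [q0 Pq0|P0]; last by rewrite big_pred0.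
pose below q := \sum_(p | lt c p q) 1.
have below_lt p q : lt c p q -> below p < below q.
  move=> pq; rewrite /below [ltnRHS](bigD1 p) //= add1n ltnS.
  rewrite [leqLHS]big_mkcond [leqRHS]big_mkcond /=; apply: leq_sum => r _.
  case: ifP => // rp; rewrite (lt_trans rp pq) /=.
  by case: eqP rp => // ->; rewrite lt_irr.
have [q Pq qmax] := arg_maxnP below Pq0.
have [r Pr rmin] := arg_minnP below Pq0.
rewrite (bigD1 q) //= mul2n -addnn leq_add ?v_leW //.
suff : pos c r + \sum_(i | P i && (i != q)) v i <= pos c q.
  by have := Pw _ Pq; have := Pw _ Pr; lia.
rewrite /pos [X in X + _]big_mkcond [X in _ + X]big_mkcond /=.
rewrite -big_split [leqRHS]big_mkcond /=; apply: leq_sum => i _.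
case: ifP => ir.
  have Pi : ~~ P i by apply/negP => /rmin; have := below_lt _ _ ir; lia.
  rewrite (negbTE Pi) /= addn0; case: (eqVneq r q) => [<-|/(lt_total c)].
    by rewrite ir.
  case/orP => rq; first by rewrite (lt_trans ir rq).
  by have := below_lt _ _ rq; have := qmax _ Pr; lia.
case: ifP => // /andP[Pi iq]; have /orP[->//|qi] := lt_total c iq.
by have := below_lt _ _ qi; have := qmax _ Pi; lia.
Qed.

(** The cells are indexed by a strip [i] and by the integral part of the mass that
has entered this strip so far, divided by [W]. While this index stays the same the
strip gains less than [W], on top of the at most [2 W] present when it took that
value. The number of cells of a strip is governed by the mass that ever enters it,
and the sum over the strips of this mass is [moved j], which a good offset makes at
most [B V ^ 2 / W]. The last assertion holds because consecutive curves occupy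
consecutive strips; it bounds the loss from a point being shared by several
cells. *)
Theorem level_cutting : exists (T : finType) (lab : nat -> Q -> T),
  [/\ #|T| * W ^ 2 <= B * V ^ 2 + V * W + 2 * W ^ 2,
      forall l, \sum_(q | [exists c : 'I_M.+1, lab c q == l]) v q <= 3 * W &
      forall c (A : {set Q}), c <= M ->
        (forall p q r, p \in A -> r \in A -> lt c p q -> lt c q r -> q \in A) ->
        #|[set lab c q | q in A]| * W <= 2 * W + \sum_(q in A) v q].
Proof.
have [j jW hj] := good_offset.
pose st c q := (pos c q + j) %/ W.
pose enter i c := \sum_(q | (st c.+1 q == i) && (st c q != i)) v q.
pose S i c := \sum_(0 <= c' < c) enter i c'.
pose I := (V %/ W).+1.
have stI c q : st c q < I.+1.
  have -> : I = (V + W) %/ W by rewrite divnDr // divnn W_gt0 addn1.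
  rewrite ltnS /st.
  by apply: leq_div2r; rewrite leq_add // ltnW.
(* [S i M %/ W] is the last index used in strip [i], [M] being the last
   column *)
pose T_ (i : 'I_I.+1) := 'I_(S i M %/ W).+1.
pose g c i : {i : 'I_I.+1 & T_ i} :=
  @Tagged _ (inord i) T_ (inord (S (inord i : 'I_I.+1) c %/ W)).
have S_mono i c c' : c <= c' -> S i c' = S i c + \sum_(c <= k < c') enter i k.
  by move=> cc; rewrite /S (big_cat_nat (leq0n c) cc).
have labE c q l : c <= M -> g c (st c q) = l ->
    st c q = tag l /\ S (tag l) c %/ W = tagged l.
  move=> cM <- /=; rewrite inordK // inordK // ltnS leq_div2r //.
  by rewrite (S_mono _ _ _ cM) leq_addr.
have st_enter c0 c i q : c0 <= c -> (st c q == i) <= (st c0 q == i) +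
    \sum_(c0 <= k < c) ((st k.+1 q == i) && (st k q != i)).
  elim: c => [|c IH]; first by rewrite leqn0 => /eqP->; rewrite big_geq // addn0.
  rewrite leq_eqVlt => /orP[/eqP<-|]; first by rewrite big_geq // addn0.
  rewrite ltnS => cc; rewrite big_nat_recr //= addnA.
  by have := IH cc; case: (st c.+1 q == i); case: (st c q == i) => /=; lia.
exists {i : 'I_I.+1 & T_ i}, (fun c q => g c (st c q)); split.
- rewrite card_tagged sumnE big_map big_enum /=.
  under eq_bigr do rewrite card_ord -addn1.
  rewrite big_split /= sum_nat_const card_ord muln1 mulnDl.
  have : (\sum_(i < I.+1) S i M %/ W) * W <= moved j.
    rewrite big_distrl /=; apply: (@leq_trans (\sum_(i < I.+1) S i M)).
      by apply: leq_sum => i _; exact: leq_divM.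
    rewrite /S; under eq_bigr do rewrite big_mkord.
    rewrite exchange_big /moved /=; apply: leq_sum => c _.
    rewrite /enter; under eq_bigr do rewrite big_mkcond /=.
    rewrite exchange_big /=; apply: leq_sum => q _.
    rewrite (bigD1 (Ordinal (stI c.+1 q))) //= big1 => [|i].
      by rewrite addn0 eqxx /= eq_sym -/(st c q) -/(st c.+1 q); case: ifP => _; lia.
    by rewrite -val_eqE /= eq_sym => /negbTE->.
  move=> hS; have hV := leq_divM V W; rewrite !expnS !expn0 !muln1.
  rewrite -addnA leq_add //.
    by rewrite mulnA (leq_trans (leq_mul hS (leqnn W))) // mulnC.
  have -> : I.+1 = V %/ W + 2 by rewrite addn2.
  by rewrite mulnDl mulnA leq_add2r leq_mul2r hV orbT.
- move=> l; set i := (tag l : nat).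
  pose P c := (c <= M) && (S i c %/ W == tagged l).
  have labP q : [exists c : 'I_M.+1, g c (st c q) == l] ->
      exists2 c, P c & st c q = i.
    case/existsP=> c /eqP hl; have cM : c <= M by rewrite -ltnS ltn_ord.
    have [hs hS] := labE _ _ _ cM hl.
    by exists c; rewrite // /P cM hS eqxx.
  case: (pickP (fun q => [exists c : 'I_M.+1, g c (st c q) == l]))
    => [q0 hq0|no]; last by rewrite big_pred0.
  have exP : exists c, P c by case: (labP _ hq0) => c; exists c.
  have bdP c : P c -> c <= M by case/andP.
  case: (ex_minnP exP) => c0 P0 c0min; case: (ex_maxnP exP bdP) => c1 P1 c1max.
  have c01 : c0 <= c1 by exact: c0min.
  (* a curve of this cell is in the strip at the first such column [c0], or
     enters it before the last one, [c1] *)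
  apply: (@leq_trans (\sum_q v q * ((st c0 q == i) +
    \sum_(c0 <= k < c1) ((st k.+1 q == i) && (st k q != i))))).
    rewrite big_mkcond /=; apply: leq_sum => q _; case: ifP => // /labP[c Pc sc].
    have c0c := c0min _ Pc; have cc1 := c1max _ Pc.
    rewrite -{1}[v q]muln1 leq_mul2l; apply/orP; right.
    have := st_enter _ _ i q c0c; rewrite sc eqxx => /leq_trans; apply.
    by rewrite leq_add2l (big_cat_nat c0c cc1) leq_addr.
  under eq_bigr do rewrite mulnDr.
  rewrite big_split /=.
  have -> : 3 * W = 2 * W + W by lia.
  apply: leq_add.
    under eq_bigr do rewrite mulnbr; rewrite -big_mkcond /=.
    apply: (window_mass (c := c0) (a := i * W - j)).
    move=> q /eqP hq; have := divn_eq (pos c0 q + j) W.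
    rewrite -/(st c0 q) hq; have := ltn_pmod (pos c0 q + j) W_gt0.
    move: (_ %% W) (i * W) => r iW; lia.
  apply: (@leq_trans (S i c1 - S i c0)).
    rewrite (S_mono _ _ _ c01) addKn; under eq_bigr do rewrite big_distrr /=.
    rewrite exchange_big /=; apply: leq_sum => k _; rewrite /enter.
    by rewrite [leqRHS]big_mkcond /=; apply: leq_sum => q _; rewrite mulnbr.
  case/andP: P0 => _ /eqP e0; case/andP: P1 => _ /eqP e1.
  have := divn_eq (S i c0) W; have := divn_eq (S i c1) W; rewrite e0 e1.
  by have := ltn_pmod (S i c1) W_gt0; lia.
- move=> c A cM Acvx.
  case: (set_0Vmem A) => [->|[q Aq]]; first by rewrite imset0 cards0 mul0n.
  have [q0 A0 q0min] := arg_minnP (pos c) Aq.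
  have [q1 A1 q1max] := arg_maxnP (pos c) Aq.
  have hA : pos c q1 <= pos c q0 + \sum_(q in A) v q.
    case: (leqP (pos c q1) (pos c q0)) => [|p01]; first by lia.
    have ltq : lt c q0 q1.
      have /(lt_total c)/orP[//|/pos_lt] : q0 != q1; last by lia.
      by apply: contraTneq p01 => ->; rewrite ltnn.
    rewrite /pos [X in X + _]big_mkcond [X in _ + X]big_mkcond /=.
    rewrite -big_split [leqLHS]big_mkcond /=; apply: leq_sum => p _.
    case: ifP => // pq1; case: ifP => [_|p0]; first by rewrite leq_addr.
    suff -> : p \in A by [].
    case: (eqVneq p q0) => [->//|/(lt_total c)]; rewrite p0 /= => p0'.
    exact: (Acvx _ _ _ A0 A1 p0' pq1).
  have sub : [set g c (st c q) | q in A] \subset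
      [set g c (st c q0 + val k) | k : 'I_(st c q1 - st c q0).+1].
    apply/fintype.subsetP => _ /imsetP[p Ap ->].
    have h0 : st c q0 <= st c p by rewrite leq_div2r ?leq_add2r ?q0min.
    have h1 : st c p <= st c q1 by rewrite leq_div2r // leq_add2r; exact: q1max.
    have hk : st c p - st c q0 < (st c q1 - st c q0).+1 by lia.
    by apply/imsetP; exists (Ordinal hk) => //=; rewrite subnKC.
  have := leq_trans (subset_leq_card sub) (leq_imset_card _ _).
  rewrite card_ord => hc.
  have h01 : st c q0 <= st c q1 by rewrite leq_div2r ?leq_add2r ?q0min.
  have := divn_eq (pos c q0 + j) W; have := divn_eq (pos c q1 + j) W.
  rewrite -/(st c q0) -/(st c q1) => e1 e0.
  apply: (leq_trans (leq_mul hc (leqnn W))); rewrite mulSn mulnBl.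
  by have := ltn_pmod (pos c q0 + j) W_gt0; lia.
Qed.
End Cutting.

(** * Rich points of an abstract incidence relation *)

(** The Cauchy-Schwarz inequality without division or roots: the summand on the
left is controlled by a geometric mean. *)
Lemma leq_sum_cauchy (I : finType) (P : pred I) (K : nat) (a b c : I -> nat) :
  (forall i, P i -> K * a i ^ 2 <= b i * c i) ->
  K * (\sum_(i | P i) a i) ^ 2 <= (\sum_(i | P i) b i) * (\sum_(i | P i) c i).
Proof.
move=> h.
have pair i j : P i -> P j -> 2 * (K * (a i * a j)) <= b i * c j + b j * c i.
  move=> /h hi /h hj; rewrite -leq_sqr.
  apply: leq_trans (nat_AGM2 _ _).
  have := leq_mul hi hj; rewrite !expnMn.
  by move: (a i) (a j) (b i) (b j) (c i) (c j) => *; nia.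
suff : 2 * (K * (\sum_(i | P i) a i) ^ 2) <=
    2 * ((\sum_(i | P i) b i) * (\sum_(i | P i) c i)) by rewrite leq_mul2l.
rewrite !expnS expn0 muln1.
have prodE f g : (\sum_(i | P i) f i) * (\sum_(i | P i) g i) =
    \sum_(i | P i) \sum_(j | P j) f i * g j :> nat.
  by rewrite big_distrl; apply: eq_bigr => i _; rewrite big_distrr.
rewrite [leqRHS]mul2n -addnn [X in _ <= _ + X]mulnC !prodE.
rewrite big_distrr [leqLHS]big_distrr -big_split /=.
apply: leq_sum => i Pi; rewrite 2!big_distrr -big_split /=.
by apply: leq_sum => j Pj; rewrite [c i * _]mulnC; exact: pair.
Qed.

Section IncidenceCauchy.
Variables (X Q : finType) (Y : {set X}) (E : X -> pred Q).
Variables (w v theta : Q -> nat) (K a b C : nat).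
Let touched q := [exists u in Y, E u q].
Hypothesis w_le : forall q, touched q -> K * w q ^ 2 <= v q * theta q.
Hypothesis theta_lea : forall q, touched q -> theta q <= a * w q.
Hypothesis theta_leb : forall q, touched q -> theta q <= b.
Hypothesis common_le : forall u u', u \in Y -> u' \in Y -> u != u' ->
  #|[pred q | E u q && E u' q]| <= C.

(** [F] is the sum of [w q * m q], where [m q] is the number of points of [Y] on the
curve [q]. The square of [m q] counts pairs of points: a pair of equal points is
paid for by [F], via [theta <= a * w], and a pair of distinct points by the bound
[C] on common curves, via [theta <= b]. The weight [theta] is left free because
these two kinds of pairs call for different choices. *)
Lemma incidence_cauchy :
  let F := \sum_(u in Y) \sum_(q | E u q) w q in
  K * F ^ 2 <= (\sum_(q | touched q) v q) * (a * F + b * C * #|Y| ^ 2).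
Proof.
rewrite /=; set F := (\sum_(u in Y) _); pose m q := \sum_(u in Y) (E u q : nat).
have FE : F = \sum_(q | touched q) w q * m q.
  rewrite /F; under eq_bigr do rewrite big_mkcond /=.
  rewrite exchange_big [RHS]big_mkcond /=; apply: eq_bigr => q _.
  case: ifP => [_|/existsPn nq].
    by rewrite big_distrr; apply: eq_bigr => u _ /=; rewrite mulnbr.
  by apply: big1 => u uY; have := nq u; rewrite uY /= => /negbTE->.
have := @leq_sum_cauchy _ touched K (fun q => w q * m q) v
  (fun q => theta q * m q ^ 2).
rewrite -FE => /(_ _)/leq_trans; apply=> [q /w_le|].
  by move=> h; rewrite expnMn mulnA [leqRHS]mulnA leq_mul2r h orbT.
rewrite leq_mul2l; apply/orP; right.
have -> : \sum_(q | touched q) theta q * m q ^ 2 = \sum_(u in Y) \sum_(u' in Y)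
    \sum_(q | touched q) theta q * (E u q && E u' q).
  under [RHS]eq_bigr do rewrite exchange_big.
  rewrite exchange_big; apply: eq_bigr => q _ /=.
  rewrite expnS expn1 big_distrl big_distrr; apply: eq_bigr => u _ /=.
  by rewrite !big_distrr; apply: eq_bigr => u' _ /=; rewrite mulnb.
have -> : a * F + b * C * #|Y| ^ 2 =
    \sum_(u in Y) (a * \sum_(q | E u q) w q + b * C * #|Y|).
  by rewrite big_split -big_distrr sum_nat_const /= expnS expn1; nia.
apply: leq_sum => u uY; rewrite (bigD1 u) //=; apply: leq_add.
  rewrite big_distrr [leqRHS]big_mkcond [leqLHS]big_mkcond; apply: leq_sum => q _ /=.
  rewrite andbb; case: ifP => tq; last by case: ifP.
  by case: (E u q); rewrite ?muln0 // muln1 theta_lea.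
rewrite -sum1_card big_distrr /=.
rewrite [leqRHS]big_mkcond [leqLHS]big_mkcond; apply: leq_sum => u' _ /=.
case: ifP => [/andP[uY' nu]|_]; last by case: ifP.
rewrite uY' muln1.
have/(leq_mul (leqnn b)) : #|[pred q | E u q && E u' q]| <= C.
  by apply: common_le => //; rewrite eq_sym.
apply: leq_trans; rewrite -sum1_card big_distrr /= [leqRHS]big_mkcond.
rewrite [leqLHS]big_mkcond; apply: leq_sum => q _ /=; rewrite inE.
case: ifP => tq; last by case: ifP.
by case: (_ && _); rewrite ?muln0 // !muln1 theta_leb.
Qed.
End IncidenceCauchy.

Section RichPoints.
Variables (X Q : finType) (inc : X -> pred Q) (C : nat).
Hypothesis C_gt0 : 0 < C.
Hypothesis common_le : forall u u', u != u' ->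
  #|[pred q | inc u q && inc u' q]| <= C.

(** When [t ^ 2] exceeds a multiple of the sum of the squared weights, no cutting is
needed. Only the curves of weight at least [t / (2 N)] are counted:
when a point carries at most [N] curves, the others contribute less than half of
the richness [t], and the counted ones are few enough to bound the number of
incidences by [2 N F / t]. *)
Lemma rich_points_without_cutting (w : Q -> nat) (S2 N t : nat) :
  0 < t -> \sum_q w q ^ 2 <= S2 -> 8 * C * S2 <= t ^ 2 ->
  (forall u, t <= 2 * \sum_(q | inc u q && (t <= 2 * N * w q)) w q) ->
  #|X| * t ^ 2 <= 8 * N * S2.
Proof.
move=> t0 hS2 hC rich.
pose E u : pred Q := fun q => inc u q && (t <= 2 * N * w q).
set F := \sum_(u : X) \sum_(q | E u q) w q.
have tF : t * #|X| <= 2 * F.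
  rewrite /F -sum1_card 2!big_distrr /=; apply: leq_sum => u _.
  by rewrite muln1; exact: rich.
have cauchy : t * F ^ 2 <=
    (\sum_(q | [exists u in [set: X], E u q]) w q ^ 2) *
    (2 * N * F + t * C * #|X| ^ 2).
  have FT : F = \sum_(u in [set: X]) \sum_(q | E u q) w q.
    by apply: eq_bigl => u; rewrite inE.
  rewrite -cardsT FT; apply: (incidence_cauchy (theta := fun=> t)) => //.
  - by move=> q _; rewrite mulnC.
  - by move=> q /existsP[u /andP[_ /andP[_]]].
  - move=> u u' _ _ uu'; apply: leq_trans (common_le uu').
    apply/subset_leq_card/fintype.subsetP => q; rewrite !inE /E.
    by case/andP => /andP[-> _] /andP[-> _].
have {}cauchy : t * F ^ 2 <= S2 * (2 * N * F + t * C * #|X| ^ 2).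
  apply: leq_trans cauchy _; rewrite leq_mul2r; apply/orP; right.
  apply: leq_trans hS2; rewrite big_mkcond.
  by apply: leq_sum => q _; case: ifP.
move: (#|X|) F tF cauchy => m F tF cauchy.
have h1 : 2 * C * S2 * m ^ 2 <= F ^ 2.
  have := leq_mul tF tF; have := leq_mul hC (leqnn (m ^ 2)); nia.
have {h1}h2 : t * F * F <= 4 * N * S2 * F.
  have := leq_mul (leqnn t) h1; move: cauchy; nia.
case: (posnP F) => F0; last by move: h2; rewrite leq_pmul2r //; nia.
by move: tF; rewrite F0 muln0 leqn0 muln_eq0 => /orP[/eqP|/eqP->]; lia.
Qed.

Section LightCurves.
Variables (M B : nat) (lt : nat -> rel Q) (col : X -> nat).
Hypothesis lt_irr : forall c, irreflexive (lt c).
Hypothesis lt_trans : forall c, transitive (lt c).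
Hypothesis lt_total : forall c x y, x != y -> lt c x y || lt c y x.
Hypothesis lt_changes :
  forall x y, \sum_(c < M) (lt c x y != lt c.+1 x y) <= B.
Hypothesis col_le : forall u, col u <= M.
Hypothesis inc_convex : forall u p q r,
  inc u p -> inc u r -> lt (col u) p q -> lt (col u) q r -> inc u q.

(** The masses [v q = k * (S2 * w q + S1 * w q ^ 2)] and the width [W = t ^ 2 * S1] are
chosen so that in a cell with [m] points either the diagonal term is dominant,
so that its weighted incidences number [O(t ^ 2 * S1 / S2)], or they number at
most [t * m / 8]. As every point carries weight at least [t], the cells of the
second kind account for at most half of the total, hence the total is at most the
number of cells times [O(t ^ 2 * S1 / S2)]. With [V = O(S1 * S2)] the number of
cells is [O(S2 ^ 2 / t ^ 4)]. The term of [v] that is linear in [w] makes the argument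
uniform in the size of the weights, with no decomposition into dyadic classes. *)
Lemma rich_points_by_cutting (w : Q -> nat) (S1 t : nat) (k := 384 * C)
    (S2 := \sum_q w q ^ 2) :
  0 < t -> \sum_q w q <= S1 -> (forall q, k * w q <= t) ->
  t ^ 2 <= 2 * k * S2 -> (forall u, t <= \sum_(q | inc u q) w q) ->
  #|X| * t ^ 3 <= 48 * (B + 3) * k * S1 * S2.
Proof.
move=> t0 hS1 wle tS2 rich.
have kE : k = 384 * C by [].
clearbody k.
have k0 : 0 < k by rewrite kE muln_gt0.
have S20 : 0 < S2.
  by rewrite lt0n; apply: contraTneq tS2 => ->; rewrite muln0 leqn0 expn_eq0; lia.
have kS2 : k * S2 <= t * S1.
  apply: (@leq_trans (t * \sum_q w q)); last by rewrite leq_mul2l hS1 orbT.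
  rewrite !big_distrr; apply: leq_sum => q _ /=.
  by rewrite expnS expn1 mulnA leq_mul2r wle orbT.
(* opaque from here on, lest rewriting distribute products over this sum *)
have S2E : \sum_q w q ^ 2 = S2 by [].
clearbody S2.
have S10 : 0 < S1.
  rewrite lt0n; apply: contraTneq kS2 => ->; rewrite muln0 leqn0 muln_eq0; lia.
pose v q := k * (S2 * w q + S1 * w q ^ 2); pose W := t ^ 2 * S1.
have v_le q : v q <= 2 * t * S1 * w q.
  have := leq_mul kS2 (leqnn (w q)).
  by have := leq_mul (wle q) (leqnn (S1 * w q)); rewrite /v; lia.
have W0 : 0 < W by rewrite muln_gt0 expn_gt0 t0.
have vW q : v q <= W.
  apply: leq_trans (v_le q) _; rewrite /W.
  have := leq_mul (leqnn (t * S1)) (wle q).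
  by have := leq_mul C_gt0 (leqnn (t * S1 * w q)); rewrite kE; lia.
have [T [lab [cardT massT splitT]]] :=
  level_cutting lt_irr lt_trans lt_total lt_changes W0 vW.
pose E l u : pred Q := fun q => inc u q && (lab (col u) q == l).
pose F l := \sum_(u : X) \sum_(q | E l u q) w q.
pose Y l := [set u | [exists q, E l u q]].
set G := \sum_(u : X) \sum_(q | inc u q) w q.
have GE : G = \sum_l F l.
  rewrite /F exchange_big; apply: eq_bigr => u _ /=.
  by rewrite (partition_big (lab (col u)) xpredT).
have tG : t * #|X| <= G.
  rewrite -sum1_card big_distrr; apply: leq_sum => u _ /=.
  by rewrite muln1 rich.
(* 384 = 6 * 64: 6 is twice the 3 of [massT], 64 the square of the 8 below *)
have cell l : 8 * (k * S2 * F l) <= 48 * t ^ 2 * S1 + k * S2 * (t * #|Y l|).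
  have FE : F l = \sum_(u in Y l) \sum_(q | E l u q) w q.
    rewrite /F [RHS]big_mkcond; apply: eq_bigr => u _; case: ifP => //.
    by rewrite inE => /existsPn nq; apply: big_pred0 => q; apply/negbTE.
  have h : k * S1 * S2 * F l ^ 2 <=
      (\sum_(q | [exists u in Y l, E l u q]) v q) *
      (S1 * F l + S2 * C * #|Y l| ^ 2).
    rewrite FE; apply: (incidence_cauchy (theta := fun q => minn (S1 * w q) S2)).
    - move=> q _; rewrite /v; case: leqP => h.
        by have := leq0n (k * S1 ^ 2 * w q ^ 3); lia.
      by have := leq0n (k * S2 ^ 2 * w q); lia.
    - by move=> q _; rewrite geq_minl.
    - by move=> q _; rewrite geq_minr.
    - move=> u u' _ _ uu'; apply: leq_trans (common_le uu').
      apply/subset_leq_card/fintype.subsetP => q; rewrite !inE /E.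
      by case/andP => /andP[-> _] /andP[-> _].
  have {}h : k * S1 * S2 * F l ^ 2 <=
      3 * W * (S1 * F l + S2 * C * #|Y l| ^ 2).
    apply: leq_trans h _; rewrite leq_mul2r; apply/orP; right.
    apply: leq_trans (massT l); rewrite big_mkcond [leqRHS]big_mkcond.
    apply: leq_sum => q _; case: ifP => // /existsP[u /andP[_ /andP[_ hl]]].
    case: ifP => // /existsPn /(_ (inord (col u))).
    by rewrite inordK ?ltnS // hl.
  move: (F l) (#|Y l|) h => f m h.
  have {}h : k * S2 * f ^ 2 <= 3 * t ^ 2 * (S1 * f + S2 * C * m ^ 2).
    by rewrite -(leq_pmul2l S10); move: h; rewrite /W; lia.
  case: (leqP (S2 * C * m ^ 2) (S1 * f)) => hm.
    case: (posnP f) => [->|f0]; first by rewrite !muln0.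
    apply: leq_trans (leq_addr _ _); rewrite -(leq_pmul2r f0).
    by have := leq_mul (leqnn (t ^ 2)) hm; lia.
  apply: leq_trans (leq_addl _ _).
  suff : 8 * f <= t * m by move=> hf; have := leq_mul (leqnn (k * S2)) hf; lia.
  rewrite -leq_sqr -(leq_pmul2l S20) -(leq_pmul2l C_gt0).
  by have := leq_mul (leqnn (t ^ 2)) (ltnW hm); move: h; rewrite kE -!mulnn; lia.
(* a point is counted once for each cell that its curves visit *)
have splitY : t * \sum_l #|Y l| <= 4 * G.
  have YE : \sum_l #|Y l| =
      \sum_(u : X) #|[set lab (col u) q | q in [set q | inc u q]]|.
    under eq_bigr do rewrite -sum1_card big_mkcond /=.
    rewrite exchange_big; apply: eq_bigr => u _ /=.
    rewrite -sum1_card [RHS]big_mkcond; apply: eq_bigr => l _ /=.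
    congr (if _ then _ else _); rewrite inE; apply/existsP/imsetP.
      by case=> q /andP[uq /eqP<-]; exists q => //; rewrite inE.
    by case=> q; rewrite inE => uq ->; exists q; rewrite /E uq eqxx.
  have : (\sum_l #|Y l|) * W <= #|X| * (2 * W) + 2 * t * S1 * G.
    rewrite YE big_distrl -sum_nat_const big_distrr -big_split /=.
    apply: leq_sum => u _; apply: leq_trans (splitT _ _ (col_le u) _) _.
      by move=> p q r; rewrite !inE; exact: inc_convex.
    rewrite leq_add2l big_distrr; under eq_bigl do rewrite inE.
    by apply: leq_sum => q _; exact: v_le.
  rewrite /W; move: (\sum_l _) (#|X|) tG => y m tG h.
  rewrite -(leq_pmul2l S10) -(leq_pmul2l t0).
  by have := leq_mul (leqnn (2 * t * S1)) tG; move: h; lia.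
have kG : k * S2 * G <= 12 * t ^ 2 * S1 * #|T|.
  have : 8 * (k * S2 * G) <=
      #|T| * (48 * t ^ 2 * S1) + k * S2 * (t * \sum_l #|Y l|).
    rewrite -sum_nat_const GE !big_distrr -big_split /=.
    by apply: leq_sum => l _; exact: cell.
  by have := leq_mul (leqnn (k * S2)) splitY; lia.
have Tt : #|T| * (t ^ 2) ^ 2 <= 4 * (B + 3) * k ^ 2 * S2 ^ 2.
  pose V' := 2 * k * S1 * S2.
  have WV' : W <= V' by rewrite /W /V'; have := leq_mul tS2 (leqnn S1); lia.
  have VV' : \sum_q v q <= V'.
    rewrite /v -big_distrr big_split -!big_distrr /= S2E /V'.
    by have := leq_mul (leqnn (k * S2)) hS1; lia.
  have : #|T| * W ^ 2 <= (B + 3) * V' ^ 2.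
    apply: leq_trans cardT _.
    have h1 := leq_mul VV' VV'; have h2 := leq_mul VV' WV'.
    by have h3 := leq_mul WV' WV'; have h4 := leq_mul (leqnn B) h1; lia.
  rewrite /W /V' => hT; rewrite -(@leq_pmul2r (S1 ^ 2)) ?expn_gt0 ?S10 //.
  by move: hT; rewrite -!mulnn; lia.
rewrite -(@leq_pmul2r (k * S2)) ?muln_gt0 ?k0 //.
have h1 := leq_mul tG (leqnn (k * S2 * t ^ 2)).
have h2 := leq_mul kG (leqnn (t ^ 2)).
have h3 := leq_mul Tt (leqnn (12 * S1)).
by move: h1 h2 h3; rewrite (expnS t 2) -!mulnn; lia.
Qed.
End LightCurves.
End RichPoints.

Local Open Scope classical_set_scope.
Local Open Scope ring_scope.

(** * Counting representations *)

Lemma leq_sum_reindex (T Q : finType) (V : eqType) (g : T -> V) (cv : Q -> V)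
    (P : pred Q) (phi : V -> nat) : injective g ->
  (forall x, (0 < phi (g x))%N -> exists2 q, P q & cv q = g x) ->
  (\sum_x phi (g x) <= \sum_(q | P q) phi (cv q))%N.
Proof.
move=> injg h.
apply: (@leq_trans (\sum_x \sum_(q | P q) (cv q == g x) * phi (cv q))).
  apply: leq_sum => x _; case: (posnP (phi (g x))) => [->//|/h[q Pq e]].
  by rewrite (bigD1 q) //= e eqxx mul1n leq_addr.
rewrite exchange_big; apply: leq_sum => q _ /=; rewrite -big_distrl /=.
rewrite -[leqRHS]mul1n leq_mul2r; apply/orP; right.
have -> : (\sum_x (cv q == g x) = \sum_(x | cv q == g x) 1)%N.
  by rewrite [RHS]big_mkcond; apply: eq_bigr => x _; case: eqP.
rewrite sum1_card; apply/card_le1_eqP => x y /eqP e /eqP e'.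
by apply: injg; rewrite -e -e'.
Qed.

Section Representations.
Variables (R : realType) (psi : R -> R) (A : {fset R}).
Local Notation N := #|` A|.
Local Notation rep := (rep psi A).

Let sums s (x : {ffun 'I_s -> A}) : R * R :=
  (\sum_i val (x i), \sum_i psi (val (x i))).

Let repE s n : rep s n = (\sum_(x : {ffun 'I_s -> A}) (sums x == n))%N.
Proof.
rewrite /Defs.rep -sum1_card big_mkcond; apply: eq_bigr => x _ /=.
by rewrite inE -pair_eqE /=; case: (_ && _).
Qed.

(** The support as a finite set, so that sums over it are sums over a finite type. *)
Definition supp s : {fset R * R} :=
  [fset n in codom (@sums s)]%fset.

Lemma mem_supp s n : (n \in supp s) = (0 < rep s n)%N.
Proof.
rewrite in_fset; apply/codomP/idP => [[x ->]|].
  by rewrite repE (bigD1 x) //= eqxx.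
rewrite repE lt0n sum_nat_eq0 => /forallPn[x]; rewrite /= eqb0 negbK => /eqP<-.
by exists x.
Qed.

Lemma sum_rep_supp s : (\sum_(q : supp s) rep s (val q) = N ^ s)%N.
Proof.
under eq_bigr do rewrite repE.
rewrite exchange_big /=.
transitivity (\sum_(x : {ffun 'I_s -> A}) 1)%N.
  apply: eq_bigr => x _.
  have xs : sums x \in supp s by rewrite in_fset codom_f.
  rewrite (bigD1 [` xs]%fset) //= eqxx big1 ?addn0 // => q.
  by rewrite -val_eqE /= eq_sym => /negbTE->.
by rewrite sum1_card card_ffun card_ord cardfE.
Qed.

(** The additive energy of order [s] of the graph of [psi] over [A]. *)
Definition energy2 s := (\sum_(q : supp s) rep s (val q) ^ 2)%N.

Lemma sum_rep2_le (X : finType) (pt : X -> R * R) s : injective pt ->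
  (\sum_u rep s (pt u) ^ 2 <= energy2 s)%N.
Proof.
move=> inj.
apply: (leq_sum_reindex (P := xpredT) (cv := val)
  (phi := fun v => (rep s v ^ 2)%N)) => // x.
by rewrite expn_gt0 orbF -mem_supp => h; exists [` h]%fset.
Qed.

Definition graph_point a : R * R := (a, psi a).

Lemma repS s u :
  rep s.+1 u = (\sum_(a : A) rep s (u - graph_point (val a))%R)%N.
Proof.
pose h (ay : A * {ffun 'I_s -> A}) : {ffun 'I_s.+1 -> A} :=
  [ffun i => if unlift ord0 i is Some j then ay.2 j else ay.1].
pose h' (x : {ffun 'I_s.+1 -> A}) := (x ord0, [ffun j => x (lift ord0 j)]).
have h0 ay : h ay ord0 = ay.1 by rewrite ffunE unlift_none.
have hl ay j : h ay (lift ord0 j) = ay.2 j by rewrite ffunE liftK.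
rewrite repE (reindex h) /=; last first.
  exists h' => [[a y] _|x _]; rewrite /h'.
    by rewrite h0; congr (_, _); apply/ffunP => j; rewrite ffunE hl.
  apply/ffunP => i; case: (unliftP ord0 i) => [j ->|->]; last by rewrite h0.
  by rewrite hl ffunE.
under [RHS]eq_bigr do rewrite repE.
rewrite pair_big /=; apply: eq_bigr.
case=> a y _; rewrite -[in RHS](inj_eq (addIr (graph_point (val a)))) subrK.
congr (nat_of_bool (_ == _)); rewrite /sums !big_ord_recl !h0.
rewrite [RHS]/GRing.add /=; congr (_, _); rewrite [RHS]addrC; congr (_ + _);
  by apply: eq_bigr => j _; rewrite hl.
Qed.

Lemma rep_le (C s : nat) u : (forall n, rep 2 n <= C)%N ->
  (rep s.+2 u <= C * N ^ s)%N.
Proof.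
move=> h; elim: s u => [|s IH] u; first by rewrite muln1.
rewrite repS; apply: leq_trans (leq_sum _ (fun a _ => IH _)) _.
by rewrite sum_nat_const -cardfE expnS mulnCA.
Qed.
End Representations.

Lemma energy3_supp (R : realType) (psi : R -> R) (A : {fset R}) s :
  energy3 psi A s = \sum_(q : supp psi A s) (rep psi A s (val q))%:R ^+ 3.
Proof.
have E : rep_support psi A s = [set` supp psi A s].
  by apply/seteqP; split=> n /=; rewrite /rep_support /= -mem_supp.
by rewrite /energy3 E -fsbig_seq ?fset_uniq // big_seq_fsetE.
Qed.

(** * Moments of a function with a weak-type bound *)

Section WeakMoments.
Variables (R : realType) (U : finType) (r : U -> nat) (H : R).
Local Notation rho u := ((r u)%:R : R).
Hypothesis weak : forall T : R, 0 < T ->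
  #|[pred u | T <= rho u]|%:R * T ^+ 3 <= H.

Let layer (p : nat) (T : R) : 0 < T ->
  \sum_(u | T <= rho u < 2 * T) rho u ^+ p <=
  #|[pred u | T <= rho u]|%:R * (2 * T) ^+ p.
Proof.
move=> T0; rewrite [leRHS]mulr_natl -sumr_const big_mkcond [leRHS]big_mkcond /=.
apply: ler_sum => u _; rewrite inE; case: ifP => [/andP[-> h]|_].
  by rewrite lerXn2r ?nnegrE ?ler0n ?mulr_ge0 // ltW.
by case: ifP => // _; rewrite exprn_ge0 // mulr_ge0 // ltW.
Qed.

Let split_layer (p J : nat) (T : R) : 0 < T ->
  \sum_(u | T <= rho u < 2 ^+ J.+1 * T) rho u ^+ p <=
  \sum_(u | T <= rho u < 2 ^+ J * T) rho u ^+ p +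
  \sum_(u | 2 ^+ J * T <= rho u < 2 * (2 ^+ J * T)) rho u ^+ p.
Proof.
move=> T0; rewrite big_mkcond [X in _ <= X + _]big_mkcond.
rewrite [X in _ <= _ + X]big_mkcond -big_split /=.
apply: ler_sum => u _; rewrite exprS -mulrA.
have h0 : 0 <= rho u ^+ p :> R by rewrite exprn_ge0.
case: (leP T) => /= h1; last by case: ifP; rewrite ?addr0 ?add0r.
by case: (leP (2 ^+ J * T)) => /= h2; case: ifP; rewrite ?addr0 ?add0r.
Qed.

Let sum_sqr_layers (J : nat) (T : R) : 0 < T ->
  \sum_(u | T <= rho u < 2 ^+ J * T) rho u ^+ 2 <=
  8 * H / T - 8 * H / (2 ^+ J * T).
Proof.
move=> T0; elim: J => [|J IH].
  rewrite expr0 mul1r subrr big_pred0 // => u.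
  by case: (leP T) => // _; apply/negbTE; rewrite -leNgt.
have T0' : 0 < 2 ^+ J * T by rewrite mulr_gt0 // exprn_gt0.
apply: le_trans (split_layer _ _ T0) _.
apply: le_trans (lerD IH (layer 2 T0')) _.
have hw : #|[pred u | 2 ^+ J * T <= rho u]|%:R * (2 * (2 ^+ J * T)) ^+ 2 <=
   4 * H / (2 ^+ J * T).
  by rewrite ler_pdivlMr //; have := weak T0'; lra.
apply: le_trans (lerD (lexx _) hw) _.
rewrite exprS -mulrA invfM; lra.
Qed.

Let sum_cube_layers (J : nat) (T : R) : 0 < T ->
  \sum_(u | T <= rho u < 2 ^+ J * T) rho u ^+ 3 <= 8 * H * J%:R.
Proof.
move=> T0; elim: J => [|J IH].
  rewrite expr0 mul1r mulr0 big_pred0 // => u.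
  by case: (leP T) => // _; apply/negbTE; rewrite -leNgt.
have T0' : 0 < 2 ^+ J * T by rewrite mulr_gt0 // exprn_gt0.
apply: le_trans (split_layer _ _ T0) _.
apply: le_trans (lerD IH (layer 3 T0')) _.
by rewrite -natr1; have := weak T0'; lra.
Qed.

Let H_ge0 : 0 <= H.
Proof. by apply: le_trans (weak ltr01); rewrite expr1n mulr1. Qed.

Let low_part (p : nat) (T : R) : 0 < T ->
  \sum_(u | rho u < T) rho u ^+ p.+1 <= T ^+ p * \sum_u rho u.
Proof.
move=> T0; rewrite big_distrr big_mkcond /=; apply: ler_sum => u _.
case: ifP => [h|_]; last by rewrite mulr_ge0 // exprn_ge0 // ltW.
by rewrite exprSr ler_wpM2r // lerXn2r ?nnegrE // ltW.
Qed.

Let split_at (p J : nat) (T : R) : (forall u, rho u < 2 ^+ J * T) ->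
  \sum_u rho u ^+ p = \sum_(u | rho u < T) rho u ^+ p +
    \sum_(u | T <= rho u < 2 ^+ J * T) rho u ^+ p.
Proof.
move=> rJ; rewrite (bigID (fun u => rho u < T)) /=; congr (_ + _).
by apply: eq_bigl => u; rewrite rJ andbT -leNgt.
Qed.

(** Below the level [T] one factor is kept and the others are replaced by [T]; above
it each of the [J] dyadic layers contributes at most [8 * H]. *)
Lemma weak_sum_cube (J : nat) (T : R) : 0 < T ->
  (forall u, rho u < 2 ^+ J * T) ->
  \sum_u rho u ^+ 3 <= T ^+ 2 * (\sum_u rho u) + 8 * H * J%:R.
Proof.
move=> T0 rJ; rewrite (split_at _ rJ) lerD //; first exact: (low_part 2).
exact: sum_cube_layers.
Qed.

(** Here the dyadic layers above [T] form a convergent geometric series, so their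
number does not matter. *)
Lemma weak_sum_sqr (T : R) : 0 < T ->
  \sum_u rho u ^+ 2 <= T * (\sum_u rho u) + 8 * H / T.
Proof.
move=> T0; pose J := Num.bound ((\sum_u rho u) / T).
have rJ u : rho u < 2 ^+ J * T.
  rewrite -ltr_pdivrMr //; apply: (@le_lt_trans _ _ ((\sum_u rho u) / T)).
    by rewrite ler_pM2r ?invr_gt0 // (bigD1 u) //= lerDl sumr_ge0.
  apply: (lt_trans (archi_boundP _)); first by rewrite divr_ge0 ?sumr_ge0 // ltW.
  by rewrite -natrX ltr_nat ltn_expl.
rewrite (split_at _ rJ) lerD //; first by rewrite -[T in leRHS]expr1 (low_part 1).
apply: le_trans (sum_sqr_layers J T0) _.
by rewrite lerBlDr lerDl divr_ge0 ?mulr_ge0 // ltW // exprn_ge0.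
Qed.
End WeakMoments.

(** * Translates of a curve *)

Lemma leq_card_at_most (R : realType) (S : set (R * R)) (n : nat)
    (T : finType) (P : pred T) (f : T -> R * R) :
  card_at_most S (n%:R : R) -> {in P &, injective f} ->
  (forall x, P x -> S (f x)) -> (#|P| <= n)%N.
Proof.
move=> [finS]; rewrite ler_nat => cardS injf fS; apply: leq_trans cardS.
pose s := [seq f x | x in P].
have us : uniq s.
  by rewrite map_inj_in_uniq ?enum_uniq // => x y; rewrite !mem_enum; exact: injf.
have -> : #|P| = size s by rewrite size_image.
have <- : #|` [fset x in s]%fset| = size s by rewrite card_fseq undup_id.
apply: fsubset_leq_card; apply/fsubsetP => y.
rewrite in_fset => /mapP[x]; rewrite mem_enum => Px ->.
by rewrite in_fset_set // inE; exact: fS.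
Qed.

Definition on_translate (R : realType) (I : set R) (psi : R -> R)
    (q u : R * R) : bool :=
  `[< I (u.1 - q.1) >] && (psi (u.1 - q.1) + q.2 == u.2).

Section Curve.
Variables (R : realType) (I : set R) (psi : R -> R) (C : nat).
Hypothesis I_itv : is_interval I.
Hypothesis psi_cont : {within I, continuous psi}.
Hypothesis diff_le : forall d1 d2,
  d1 != 0 -> card_at_most (difference_pairs I psi d1 d2) (C%:R : R).
Hypothesis C_gt0 : (0 < C)%N.

Let shift_cont (a b p : R) : (forall z, a <= z <= b -> I (z - p)) ->
  {within `[a, b], continuous (fun z => psi (z - p))}.
Proof.
move=> abI; apply/subspace_continuousP => z; rewrite /= in_itv /= => zab.
have /subspace_continuousP/(_ _ (abI _ zab)) := psi_cont; apply: cvg_comp.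
move=> W; rewrite /within /= => nW.
have : (fun y => y - p) @ z --> z - p.
  by apply: cvgB; [exact: cvg_id|exact: cvg_cst].
move=> /(_ _ nW) hW.
have {}hW : nbhs z [set y | I (y - p) -> W (y - p)] by exact: hW.
apply: filterS hW => y hy yab.
by apply: hy; apply: abI; move: yab; rewrite in_itv.
Qed.

(** Two translates that exchange their order between the abscissas [a] and [b] meet in
between, and a meeting point is a solution of the difference equation. *)
Lemma crossing_point (a b : R) (p q : R * R) : a <= b ->
  I (a - p.1) -> I (b - p.1) -> I (a - q.1) -> I (b - q.1) ->
  psi (a - p.1) + p.2 <= psi (a - q.1) + q.2 ->
  psi (b - q.1) + q.2 <= psi (b - p.1) + p.2 ->
  exists2 z, a <= z <= b & difference_pairs I psi (q.1 - p.1) (q.2 - p.2)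
    (z - p.1, z - q.1).
Proof.
move=> ab pa pb qa qb ha hb.
have inI r : I (a - r) -> I (b - r) -> forall z, a <= z <= b -> I (z - r).
  move=> Ia Ib z /andP[az zb]; apply: (I_itv Ia Ib).
  by rewrite !lerD2r az zb.
pose g z := psi (z - p.1) - psi (z - q.1).
have gc : {within `[a, b], continuous g}.
  move=> z; apply: (@continuousB _ _ (subspace `[a, b])).
    exact: (shift_cont (inI _ pa pb)).
  exact: (shift_cont (inI _ qa qb)).
have [|z zab gz] := IVT (v := q.2 - p.2) ab gc.
  by rewrite /g ge_min le_max; apply/andP; split; apply/orP; [left|right]; lra.
exists z; first by move: zab; rewrite in_itv.
move: zab; rewrite in_itv /= => zab.
by split; rewrite /= ?opprB; [exact: inI|exact: inI|lra|].
Qed.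

Section Translates.
Variables (X Q : finType) (pt : X -> R * R) (cv : Q -> R * R).
Hypothesis pt_inj : injective pt.
Hypothesis cv_inj : injective cv.

Let inc u : pred Q := fun q => on_translate I psi (cv q) (pt u).

(** The translates through two given points correspond to the solutions of the
difference equation given by these points. *)
Lemma common_translates_le u u' : u != u' ->
  (#|[pred q | inc u q && inc u' q]| <= C)%N.
Proof.
move=> uu'; have [e1|ne1] := eqVneq (pt u).1 (pt u').1.
  apply: (@leq_trans 0) => //; rewrite leqn0; apply/eqP/eq_card0 => q.
  rewrite !inE; apply/negbTE; apply: contra uu'.
  case/andP=> /andP[_ /eqP hu] /andP[_ /eqP hu'].
  apply/eqP/pt_inj; rewrite [pt u]surjective_pairing [pt u']surjective_pairing.
  by rewrite -hu -hu' e1.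
have d0 : (pt u).1 - (pt u').1 != 0 by rewrite subr_eq0.
apply: (leq_card_at_most (f := fun q => ((pt u).1 - (cv q).1, (pt u').1 - (cv q).1))
  (diff_le ((pt u).2 - (pt u').2) d0)).
- move=> q r; rewrite !inE => /andP[/andP[_ /eqP hq] _].
  move=> /andP[/andP[_ /eqP hr] _] [/addrI/oppr_inj e _]; apply: cv_inj.
  rewrite [cv q]surjective_pairing [cv r]surjective_pairing e.
  by congr (_, _); move: hq; rewrite -hr e => /addrI.
- move=> q; rewrite !inE => /andP[/andP[/asboolP Iq /eqP hq]].
  move=> /andP[/asboolP Iq' /eqP hq']; split=> //=.
    by rewrite opprB addrA subrK.
  by rewrite -hq -hq'; ring.
Qed.

Let xs := sort <=%R (undup [seq (pt u).1 | u : X]).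
Let x c := nth 0 xs c.
Let M := (size xs).-1.
Let col u := index (pt u).1 xs.

Let xs_lt c c' : (c < c')%N -> (c' < size xs)%N -> x c < x c'.
Proof.
move=> cc' c's; apply: (@sorted_ltn_nth _ _ lt_trans 0 xs) => //.
  by rewrite sort_lt_sorted undup_uniq.
by rewrite inE (ltn_trans cc').
Qed.

Let xs_col u : (col u < size xs)%N.
Proof. by rewrite index_mem mem_sort mem_undup; apply: map_f; rewrite mem_enum. Qed.

Let x_col u : x (col u) = (pt u).1.
Proof. by apply: nth_index; rewrite -index_mem; exact: xs_col. Qed.

(* Outside its domain a curve is placed below all the others, so that every
   column orders the same set of curves. *)
Let def c q : bool := `[< I (x c - (cv q).1) >].
Let ht c q : \bar R :=
  if def c q then (psi (x c - (cv q).1) + (cv q).2)%:E else -oo%E.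
Let lt c : rel Q := fun p q =>
  (ht c p < ht c q)%O || (ht c p == ht c q) && (enum_rank p < enum_rank q)%N.

Let lt_irr c : irreflexive (lt c).
Proof. by move=> p; rewrite /lt ltxx ltnn andbF. Qed.

Let lt_tr c : transitive (lt c).
Proof.
move=> q p r /orP[pq|/andP[/eqP pq ipq]] /orP[qr|/andP[/eqP qr iqr]].
- by apply/orP; left; exact: lt_trans pq qr.
- by apply/orP; left; rewrite -qr.
- by apply/orP; left; rewrite pq.
- by apply/orP; right; rewrite pq qr eqxx /=; exact: ltn_trans ipq iqr.
Qed.

Let lt_tot c p q : p != q -> lt c p q || lt c q p.
Proof.
move=> pq; rewrite /lt; case: ltgtP => //= _; rewrite -neq_ltn.
by apply: contra pq => /eqP/val_inj/enum_rank_inj->.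
Qed.

Let ht_le c p q : lt c p q -> (ht c p <= ht c q)%O.
Proof. by case/orP=> [/ltW//|/andP[/eqP->]]. Qed.

Let inc_cvx u p q r :
  inc u p -> inc u r -> lt (col u) p q -> lt (col u) q r -> inc u q.
Proof.
move=> hp hr /ht_le pq /ht_le qr.
have htu s : inc u s -> ht (col u) s = ((pt u).2)%:E.
  by case/andP=> hs /eqP<-; rewrite /ht /def x_col hs.
have : ht (col u) q = ((pt u).2)%:E.
  by apply/eqP; rewrite eq_le -{1}(htu _ hr) -(htu _ hp) qr pq.
rewrite /ht /inc /on_translate /def x_col; case: ifP => // _ [->].
by rewrite eqxx.
Qed.

Let ltS c p q : lt c p q -> ~~ lt c.+1 p q -> def c p -> def c q ->
  def c.+1 p -> def c.+1 q -> (c.+1 < size xs)%N ->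
  exists2 z, x c <= z <= x c.+1 & difference_pairs I psi
    ((cv q).1 - (cv p).1) ((cv q).2 - (cv p).2) (z - (cv p).1, z - (cv q).1).
Proof.
move=> /ht_le h h' pc qc pc' qc' cs.
have {}h' : (ht c.+1 q <= ht c.+1 p)%O.
  by rewrite leNgt; apply: contra h'; rewrite /lt => ->.
move: h h'; rewrite /ht pc qc pc' qc' !lee_fin => h h'.
by apply: crossing_point => //; [exact/ltW/xs_lt|exact/asboolP..].
Qed.

Let card_le1_of_neq (P : pred 'I_M) :
  (forall c c' : 'I_M, (c < c')%N -> c \in P -> c' \in P -> False) -> (#|P| <= 1)%N.
Proof.
move=> h; apply/card_le1_eqP => c c' Pc Pc'; apply/eqP; apply/negPn/negP.
by rewrite -val_eqE neq_ltn => /orP[] /h; [move/(_ Pc' Pc)|move/(_ Pc Pc')].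
Qed.

Let ord_size (c : 'I_M) : (c.+1 < size xs)%N.
Proof. by move: (ltn_ord c); move: (nat_of_ord c) => k; rewrite /M; lia. Qed.

Let def_cvx c c' c'' q : (c <= c' <= c'')%N -> (c'' < size xs)%N ->
  def c q -> def c'' q -> def c' q.
Proof.
have x_le a b : (a <= b)%N -> (b < size xs)%N -> x a <= x b.
  by rewrite leq_eqVlt => /orP[/eqP->//|ab bs]; exact/ltW/xs_lt.
case/andP=> h h' cs /asboolP Ic /asboolP Ic''; apply/asboolP.
by apply: (I_itv Ic Ic''); rewrite !lerD2r !x_le // (leq_ltn_trans h').
Qed.

Let def_changes q : (\sum_(c < M) (def c q != def c.+1 q) <= 2)%N.
Proof.
apply: (@leq_trans (#|[pred c : 'I_M | ~~ def c q && def c.+1 q]| +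
  #|[pred c : 'I_M | def c q && ~~ def c.+1 q]|)).
  rewrite -!sum1_card [X in (_ <= X + _)%N]big_mkcond.
  rewrite [X in (_ <= _ + X)%N]big_mkcond -big_split /=.
  by apply: leq_sum => c _; rewrite !inE; case: def; case: def.
apply: (@leq_add _ _ 1 1); apply: card_le1_of_neq => c c' cc'; rewrite !inE.
  case/andP=> _ h /andP[/negP h' h'']; apply: h'.
  by apply: (def_cvx _ _ h h''); rewrite ?cc' ?leqnSn ?ord_size.
case/andP=> h /negP h' /andP[h'' _]; apply: h'.
by apply: (def_cvx _ _ h h'');
  [rewrite leqnSn cc'|exact: ltn_trans (ltnSn _) (ord_size _)].
Qed.

Let lt_undefl c p q : ~~ def c p ->
  lt c p q = def c q || (enum_rank p < enum_rank q)%N.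
Proof.
move=> /negbTE hp; rewrite /lt /ht hp.
by case: (def c q); rewrite ?ltNyr ?ltxx ?eqxx.
Qed.

Let lt_undefr c p q : ~~ def c q ->
  lt c p q = ~~ def c p && (enum_rank p < enum_rank q)%N.
Proof.
move=> /negbTE hq; rewrite /lt /ht hq.
by case: (def c p); rewrite ?ltxx ?eqxx.
Qed.

Let crossing p q c := [&& def c p, def c.+1 p, def c q, def c.+1 q &
  lt c p q != lt c.+1 p q].

(* Between columns where both curves are defined a change of order produces a
   meeting point. Columns of the same parity produce distinct points, whereas
   the same point may serve two neighbouring columns. *)
Let crossing_le p q b : p != q ->
  (#|[pred c : 'I_M | crossing p q c && (odd c == b)]| <= C)%N.
Proof.
move=> pq; pose Z c z := x c <= z <= x c.+1 /\ difference_pairs I psi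
    ((cv q).1 - (cv p).1) ((cv q).2 - (cv p).2) (z - (cv p).1, z - (cv q).1).
have Zex c : (c.+1 < size xs)%N -> crossing p q c -> exists z, Z c z.
  move=> cs /and5P[pc pc' qc qc' h].
  have [ltc|nltc] := boolP (lt c p q).
    have nltc' : ~~ lt c.+1 p q by move: h; rewrite ltc; case: lt.
    by have [z h1 h2] := ltS ltc nltc' pc qc pc' qc' cs; exists z.
  have ltc' : lt c.+1 p q by move: h; rewrite (negbTE nltc); case: lt.
  have ltc : lt c q p by have := lt_tot c pq; rewrite (negbTE nltc).
  have nltc' : ~~ lt c.+1 q p.
    by apply/negP => /(lt_tr ltc'); rewrite lt_irr.
  have [z h1 [h2 h3 h4 h5]] := ltS ltc nltc' qc pc qc' pc' cs.
  by exists z; split=> //; split=> //=; [rewrite -opprB h4 opprB|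
    rewrite -opprB h5 opprB].
pose z c := xget 0 [set y | Z c y].
have zP (c : 'I_M) : crossing p q c -> Z c (z c).
  by move=> /(Zex _ (ord_size c))[y hy]; exact: (xgetI _ hy).
have [e|ne] := eqVneq (cv p).1 (cv q).1.
  apply: (@leq_trans 0) => //; rewrite leqn0; apply/eqP/eq_card0 => c.
  rewrite !inE; apply/negbTE/negP => /andP[/zP[_ [_ _ _ /= h]] _].
  move: pq; apply/negP/negPn/eqP/cv_inj.
  rewrite [cv p]surjective_pairing [cv q]surjective_pairing e.
  by congr (_, _); move: h; rewrite e subrr => /eqP; rewrite eq_sym subr_eq0 => /eqP.
have d0 : (cv q).1 - (cv p).1 != 0 by rewrite subr_eq0 eq_sym.
apply: (leq_card_at_most (f := fun c : 'I_M => (z c - (cv p).1, z c - (cv q).1))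
  (diff_le ((cv q).2 - (cv p).2) d0)).
- suff zlt (c c' : 'I_M) : crossing p q c && (odd c == b) ->
      crossing p q c' && (odd c' == b) -> (c < c')%N -> z c < z c'.
    move=> c c'; rewrite !inE => hc hc' [/addIr e _]; apply/eqP/negPn/negP.
    rewrite -val_eqE neq_ltn => /orP[/(zlt _ _ hc hc')|/(zlt _ _ hc' hc)];
    by rewrite e ltxx.
  case/andP=> /zP[/andP[_ h] _] /eqP oc /andP[/zP[/andP[h' _] _] /eqP oc'] cc'.
  apply: le_lt_trans h (lt_le_trans _ h'); apply: xs_lt; last first.
    exact: ltn_trans (ltnSn _) (ord_size c').
  rewrite ltn_neqAle cc' andbT; apply/eqP => e.
  by move: oc'; rewrite -e /= oc; case: (b).
- by move=> c; rewrite inE => /andP[/zP[_ h] _].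
Qed.

Let lt_changes p q :
  (\sum_(c < M) (lt c p q != lt c.+1 p q) <= 2 * C + 4)%N.
Proof.
have [->|pq] := eqVneq p q.
  by rewrite big1 // => c _; rewrite !lt_irr.
have h := leq_add (leq_add (crossing_le true pq) (crossing_le false pq))
  (leq_add (def_changes p) (def_changes q)).
apply: leq_trans (leq_trans h _); last by rewrite mul2n -addnn.
rewrite -!sum1_card [X in (_ <= X + _ + _)%N]big_mkcond.
rewrite [X in (_ <= _ + X + _)%N]big_mkcond -!big_split /=.
apply: leq_sum => c _; rewrite !inE /crossing.
have [dp|np] := boolP (def c p); have [dq|nq] := boolP (def c q);
  have [dp'|np'] := boolP (def c.+1 p); have [dq'|nq'] := boolP (def c.+1 q);
  rewrite /= ?addn0 ?addn1 //; try by case: (_ != _).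
- by case: (_ != _) => //=; case: (odd c).
- by rewrite !lt_undefr // dp dp'.
- by rewrite !lt_undefl // dq dq'.
- by rewrite !lt_undefl // (negbTE nq) (negbTE nq') eqxx.
Qed.

(** A pair of translates changes order at most [2 C + 4] times: [C] meeting points
used twice each, and the two ends of the domain of each curve. *)
Theorem rich_points_translates (w : Q -> nat) (S1 t : nat) (k := (384 * C)%N)
    (S2 := (\sum_q w q ^ 2)%N) :
  (0 < t)%N -> (\sum_q w q <= S1)%N ->
  (forall q, k * w q <= t)%N -> (t ^ 2 <= 2 * k * S2)%N ->
  (forall u, t <= \sum_(q | on_translate I psi (cv q) (pt u)) w q)%N ->
  (#|X| * t ^ 3 <= 48 * (2 * C + 7) * k * S1 * S2)%N.
Proof.
move=> t0 hS1 hw ht2 rich.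
have -> : (2 * C + 7 = 2 * C + 4 + 3)%N by rewrite -addnA.
have col_le u : (col u <= M)%N by have := xs_col u; rewrite /M; lia.
exact: (rich_points_by_cutting C_gt0 common_translates_le lt_irr lt_tr lt_tot
  lt_changes col_le inc_cvx t0 hS1 hw ht2 rich).
Qed.
End Translates.

(** * The weak-type bound *)

(** The terms come, in this order, from the heavy curves, from the cutting and from
the large values of [t]. *)
Definition weak_const (n : nat) : nat :=
  (384 * n) ^ 2 * n + 48 * (2 * n + 7) * (384 * n) + 8 * n.

Section WeakType.
Variables (A : {fset R}) (s : nat).
Hypothesis AI : [set` A] `<=` I.
Local Notation N := #|` A|.
Hypothesis rep_bound : forall u, (rep psi A s.+3 u <= C * N ^ s.+1)%N.
Let k := (384 * C)%N.
Let r := rep psi A s.+2.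
Let E2 := energy2 psi A s.+2.
Local Notation pointA a := (graph_point psi (val (a : A))).

Let translate_inj u : injective (fun a : A => u - pointA a).
Proof. by move=> a b [/addrI/oppr_inj/val_inj]. Qed.

Let on_translateA (u q : R * R) (a : A) :
  q = u - pointA a -> on_translate I psi q u.
Proof.
move=> ->; rewrite /on_translate /= !subKr; apply/andP; split.
  by apply/asboolP/AI; exact: valP.
by rewrite addrC subrK.
Qed.

(** A curve [q] is too heavy for [rich_points_by_cutting] if [k * r q > t].
There are at most [k ^ 2 * E2 / t ^ 2] of these, with [N] relevant points each, which
is acceptable since [t <= C * N ^ s.+1]. The remaining points get all their richness
from the light curves, and [rich_points_by_cutting] or [rich_points_without_cutting]
applies to these according to the size of [t]. *)
Lemma rich_points_rep (X : finType) (pt : X -> R * R) (t : nat) :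
  injective pt -> (0 < t)%N -> (forall u, t <= rep psi A s.+3 (pt u))%N ->
  (#|X| * t ^ 3 <= weak_const C * N ^ s.+2 * E2)%N.
Proof.
move=> ptI t0 rich; rewrite /weak_const -/k.
case: (pickP (fun _ : X => true)) => [u0 _|X0]; last by rewrite eq_card0.
have Nt : (N * t <= C * N ^ s.+2)%N.
  rewrite [in leqRHS]expnS mulnCA leq_mul2l.
  by rewrite (leq_trans (rich u0) (rep_bound _)) orbT.
pose heavy u := [exists a : A, t < k * r (pt u - pointA a)%R]%N.
have heavy_le : (#|heavy| * t ^ 2 <= k ^ 2 * (N * E2))%N.
  rewrite -sum_nat_const.
  apply: (@leq_trans (\sum_u \sum_(a : A) k ^ 2 * r (pt u - pointA a)%R ^ 2)).
    rewrite big_mkcond; apply: leq_sum => u _; case: ifP => // /existsP[a ha].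
    by rewrite (bigD1 a) //= (leq_trans _ (leq_addr _ _)) // -expnMn leq_sqr ltnW.
  rewrite exchange_big cardfE -sum_nat_const big_distrr.
  apply: leq_sum => a _ /=; rewrite -big_distrr leq_mul2l; apply/orP; right.
  by apply: (@sum_rep2_le _ _ _ _ (fun u => (pt u - pointA a)%R)) => u v /addIr/ptI.
have {}heavy_le : (#|heavy| * t ^ 3 <= k ^ 2 * C * N ^ s.+2 * E2)%N.
  have := leq_mul heavy_le (leqnn t); have := leq_mul Nt (leqnn (k ^ 2 * E2)).
  rewrite (expnSr t 2); move: (N ^ s.+2)%N => n; lia.
(* the points on no heavy curve, with the heavy weights erased *)
pose X' := {u : X | ~~ heavy u}; pose pt' (u : X') := pt (val u).
have pt'I : injective pt' by move=> u v /ptI/val_inj.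
pose w0 v := (if k * r v <= t then r v else 0)%N.
pose w (q : supp psi A s.+2) := w0 (val q).
have w_r q : (w q <= r (val q))%N by rewrite /w /w0; case: ifP.
have sum_light (u : X') : (\sum_(a : A) w0 (pt' u - pointA a)%R =
    rep psi A s.+3 (pt' u))%N.
  rewrite repS; apply: eq_bigr => a _; rewrite /w0; case: leqP => // h.
  by have /existsPn/(_ a) := valP u; rewrite h.
have to_curve (u : X') (a : A) : (0 < w0 (pt' u - pointA a)%R)%N ->
    exists2 q : supp psi A s.+2, on_translate I psi (val q) (pt' u) &
      val q = pt' u - pointA a.
  rewrite /w0; case: ifP => // _; rewrite -mem_supp => h.
  by exists [` h]%fset => //=; exact: on_translateA.
have richw (u : X') :
    (t <= \sum_(q | on_translate I psi (val q) (pt' u)) w q)%N.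
  apply: leq_trans (rich (val u)) _; rewrite -/(pt' u) -sum_light.
  exact: (leq_sum_reindex (@translate_inj (pt' u)) (to_curve u)).
have S1w : (\sum_q w q <= N ^ s.+2)%N.
  by rewrite -(sum_rep_supp psi); apply: leq_sum => q _; exact: w_r.
have S2w : (\sum_q w q ^ 2 <= E2)%N.
  by apply: leq_sum => q _; rewrite leq_sqr.
have w_le q : (k * w q <= t)%N.
  by rewrite /w /w0; case: ifP => //; rewrite muln0.
have light_le : (#|{: X'}| * t ^ 3 <=
    (48 * (2 * C + 7) * k + 8 * C) * N ^ s.+2 * E2)%N.
  have [small|big] := leqP (t ^ 2) (2 * k * \sum_q w q ^ 2).
    have := rich_points_translates pt'I val_inj t0 S1w w_le small richw.
    move=> /leq_trans; apply.
    have := leq_mul (leqnn (48 * (2 * C + 7) * k * N ^ s.+2)%N) S2w.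
    have := leq0n (8 * C * N ^ s.+2 * E2).
    rewrite -/k; move: (48 * (2 * C + 7) * k)%N (N ^ s.+2)%N.
    by move: (\sum_q w q ^ 2)%N E2; clear; move=> *; lia.
  have : (#|{: X'}| * t ^ 2 <= 8 * N * \sum_q w q ^ 2)%N.
    apply: (rich_points_without_cutting C_gt0
      (common_translates_le pt'I val_inj) t0 (leqnn _)).
      by apply: leq_trans (ltnW big); rewrite /k; move: (\sum_q _)%N; clear; lia.
    move=> u.
    pose w1 v := (if t <= 2 * N * w0 v then w0 v else 0)%N.
    have h1 : (\sum_(a : A) w1 (pt' u - pointA a)%R <=
       \sum_(q | on_translate I psi (val q) (pt' u) && (t <= 2 * N * w q)) w q)%N.
      apply: (@leq_trans (\sum_(q | on_translate I psi (val q) (pt' u) &&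
         (t <= 2 * N * w q)%N) w1 (val q))); last first.
        by apply: leq_sum => q _; rewrite /w1; case: ifP.
      apply: (leq_sum_reindex (@translate_inj (pt' u))) => a.
      rewrite /w1; case: ifP => // ha /to_curve[q onq vq]; exists q => //.
      by rewrite onq /w vq.
    have h2 : (2 * N * \sum_(a : A) w0 (pt' u - pointA a)%R <=
       2 * N * (\sum_(a : A) w1 (pt' u - pointA a)%R) + N * t)%N.
      rewrite [in X in (_ + X * _)%N]cardfE -sum_nat_const !big_distrr -big_split /=.
      apply: leq_sum => a _; rewrite /w1; move: (w0 _) => z.
      by case: (leqP t (2 * N * z)%N) => /=; clear; lia.
    have N0 : (0 < N)%N.
      have := leq_trans t0 (leq_trans (rich u0) (rep_bound _)).
      by rewrite muln_gt0 expn_gt0 orbF => /andP[].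
    apply: leq_trans (leq_mul (leqnn 2) h1).
    move: h2; rewrite sum_light; have := rich (val u); rewrite -/(pt' u) => h3 h2.
    rewrite -(leq_pmul2l N0).
    by have := leq_mul (leqnn (2 * N)%N) h3; move: h2; clear; lia.
  move=> h; have := leq_mul h (leqnn t); have := leq_mul Nt S2w.
  have := leq0n (48 * (2 * C + 7) * k * N ^ s.+2 * E2).
  rewrite (expnSr t 2).
  move: (48 * (2 * C + 7) * k)%N (N ^ s.+2)%N (\sum_q _)%N E2 (#|_|).
  by clear; move=> *; lia.
have -> : #|X| = (#|heavy| + #|{: X'}|)%N.
  by rewrite -(cardC heavy) card_sig.
move: heavy_le light_le; move: (48 * (2 * C + 7) * k)%N (N ^ s.+2)%N E2.
by move: (#|heavy|) (#|{: X'}|); clear; move=> *; lia.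
Qed.
End WeakType.

(** * Induction on the number of summands *)

(** The root of [x] of order [2 ^ m.+1]. Its recursive form makes the halving of the
exponent in the induction on [s] an identity between monomials. *)
Definition root_pow (F : realType) (x : F) m := iter m.+1 Num.sqrt x.

Lemma root_powE (F : realType) (x : F) m : 0 <= x ->
  root_pow x m ^+ 2 = x `^ (2^-1 ^+ m).
Proof.
move=> x0.
have h k : root_pow x k = x `^ (2^-1 ^+ k.+1).
  elim: k => [|k IH]; first by rewrite expr1 powR12_sqrt.
  by rewrite /root_pow iterS -/(root_pow x k) IH -powR12_sqrt ?powR_ge0 //
    -powRrM [in RHS]exprSr.
by rewrite h -powR_mulrn ?powR_ge0 // -powRrM exprSr -mulrA mulVf ?mulr1.
Qed.

(** In the bound for the second moment the low values contribute 1 and the dyadic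
layers [8 * weak_const C]. *)
Definition growth (F : realType) (n : nat) : F := 1 + 8 * (weak_const n)%:R.

Section Bounds.
Hypothesis sum_le : forall n1 n2, card_at_most (sum_pairs I psi n1 n2) (C%:R : R).
Variables (A : {fset R}).
Hypothesis AI : [set` A] `<=` I.
Hypothesis A_gt1 : (1 < #|` A|)%N.
Let N : R := #|` A|%:R.
Let K := weak_const C.
Let rho s (u : supp psi A s) : R := (rep psi A s (val u))%:R.

Let rep2_le u : (rep psi A 2 u <= C)%N.
Proof.
apply: (leq_card_at_most
  (f := fun x : {ffun 'I_2 -> A} => (val (x ord0), val (x ord_max)))
  (sum_le u.1 u.2)).
  move=> x x' _ _ [/val_inj e0 /val_inj e1]; apply/ffunP => i.
  case: (unliftP ord0 i) => [j ->|->//].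
  by rewrite (ord1 j) (_ : lift _ _ = ord_max) //; apply: val_inj.
move=> x /=; rewrite !big_ord_recl !big_ord0 !addr0 => /andP[/eqP h1 /eqP h2].
have e : lift ord0 ord0 = ord_max :> 'I_2 by apply: val_inj.
rewrite e in h1 h2.
by split=> //=; apply: AI; exact: valP.
Qed.

Let rep_bound s u : (rep psi A s.+2 u <= C * #|` A| ^ s)%N.
Proof. exact: rep_le. Qed.

Let weak_rep s (T : R) : 0 < T ->
  #|[pred u | T <= rho (u : supp psi A s.+3)]|%:R * T ^+ 3 <=
  K%:R * N ^+ s.+2 * (energy2 psi A s.+2)%:R.
Proof.
move=> T0; set P := [pred u | _].
case: (pickP P) => [u0 Pu0|P0]; last first.
  rewrite (eq_card0 P0) mul0r mulr_ge0 // mulr_ge0 //.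
  by rewrite exprn_ge0.
have [v Pv vmin] :=
  arg_minnP (fun u : supp psi A s.+3 => rep psi A s.+3 (val u)) Pu0.
set t := rep psi A s.+3 (val v) in vmin.
have Tt : T <= t%:R by exact: Pv.
have t0 : (0 < t)%N by rewrite -(ltr_nat R) (lt_le_trans T0).
pose X := {u | P u}.
have ptI : injective (fun u : X => val (val u)) by move=> u u' /val_inj/val_inj.
have rich (u : X) : (t <= rep psi A s.+3 (val (val u)))%N.
  by apply: vmin; exact: valP.
have := rich_points_rep AI (@rep_bound s.+1) ptI t0 rich.
rewrite card_sig -(ler_nat R) -/K natrM natrX.
rewrite natrM [X in _ <= X * _]natrM natrX; apply: le_trans.
by rewrite ler_wpM2l // lerXn2r ?nnegrE // ltW.
Qed.

Let q : R := growth R C.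
Let y := root_pow N.

Let N_ge1 : 1 <= N. Proof. by rewrite ler1n; exact: ltnW. Qed.
Let N_gt0 : 0 < N. Proof. exact: lt_le_trans N_ge1. Qed.
Let y_ge1 m : 1 <= y m.
Proof.
rewrite /y /root_pow; elim: m => [|m IH]; rewrite iterS -[leLHS]sqrtr1.
  exact: ler_wsqrtr.
exact: ler_wsqrtr.
Qed.
Let y_gt0 m : 0 < y m. Proof. exact: lt_le_trans (y_ge1 m). Qed.

Let C_leq : C%:R <= q.
Proof.
have : C%:R <= K%:R :> R by rewrite ler_nat /K /weak_const; lia.
by have := ler0n R K; rewrite /q /growth -/K; lra.
Qed.

Let sum_rho s : \sum_u rho (u : supp psi A s) = N ^+ s.
Proof. by rewrite /rho -natr_sum sum_rep_supp natrX. Qed.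

Let energy2_rho s : (energy2 psi A s)%:R = \sum_u rho (u : supp psi A s) ^+ 2.
Proof. by rewrite /energy2 natr_sum; apply: eq_bigr => u _; rewrite natrX. Qed.

(** The right-hand side is [N * T ^ 2] for [T = q * N ^ m * y m], which is the level
to use in [weak_sum_sqr] for the next energy: both terms of that bound are then
multiples of [N ^ m.+3 * T], with sum of coefficients [1 + 8 * K = q], so the same
[q] reappears. *)
Lemma energy2_le m :
  (energy2 psi A m.+2)%:R <= q ^+ 2 * N ^+ (2 * m).+1 * y m ^+ 2.
Proof.
have q1 : 1 <= q by rewrite /q /growth lerDl mulr_ge0.
have q0 : 0 < q by apply: lt_le_trans q1.
elim: m => [|m IH].
  rewrite /y /root_pow /= sqr_sqrtr ?(ltW N_gt0) // expr1.
  rewrite energy2_rho; apply: (@le_trans _ _ (C%:R * \sum_u rho (u : supp psi A 2))).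
    rewrite big_distrr; apply: ler_sum => u _ /=.
    by rewrite expr2 ler_wpM2r // /rho ler_nat.
  rewrite sum_rho -mulrA -expr2 ler_wpM2r ?exprn_ge0 ?(ltW N_gt0) //.
  by rewrite (le_trans C_leq) // expr2 ler_peMl // ltW.
pose T := q * N ^+ m * y m.
have T0 : 0 < T by rewrite !mulr_gt0 // exprn_gt0.
rewrite energy2_rho; apply: le_trans (weak_sum_sqr (@weak_rep m) T0) _.
rewrite sum_rho.
have yS : y m.+1 ^+ 2 = y m.
  have -> : y m.+1 = Num.sqrt (y m) by [].
  by rewrite sqr_sqrtr // ltW.
rewrite yS.
have -> : q ^+ 2 * N ^+ (2 * m.+1).+1 * y m =
    T * N ^+ m.+3 + (q - 1) * N ^+ m.+3 * T.
  rewrite /T (_ : (2 * m.+1).+1 = m + m.+3)%N; last by lia.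
  by rewrite exprD; ring.
rewrite lerD2l ler_pdivrMr //.
have -> : q - 1 = 8 * K%:R by rewrite /q /growth addrC addKr.
have -> : 8 * K%:R * N ^+ m.+3 * T * T =
    8 * (K%:R * N ^+ m.+2 * (q ^+ 2 * N ^+ (2 * m).+1 * y m ^+ 2)).
  rewrite /T (_ : (2 * m).+1 = (m + m).+1)%N; last by lia.
  by rewrite !exprS exprD; ring.
by rewrite ler_wpM2l // ler_wpM2l // mulr_ge0 // exprn_ge0 // ltW.
Qed.

(** With the same level [T], the low part of the third moment is at most the bound for
a single dyadic layer, and [T >= q * N ^ m] leaves at most [J] layers below the maximum
[C * N ^ m.+1] as soon as [2 ^ J > N]. *)
Lemma energy3_le m : energy3 psi A m.+3 <=
  2 * q ^+ 3 / ln 2 * (N ^+ (3 * m.+1) * y m ^+ 2 * ln N).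
Proof.
have q1 : 1 <= q by rewrite /q /growth lerDl mulr_ge0.
have q0 : 0 < q by apply: lt_le_trans q1.
pose T := q * N ^+ m * y m.
have T0 : 0 < T by rewrite !mulr_gt0 // exprn_gt0.
pose J := (trunc_log 2 #|` A|).+1.
have NJ : N < 2 ^+ J by rewrite -natrX ltr_nat trunc_log_ltn.
have rho_lt (u : supp psi A m.+3) : rho u < 2 ^+ J * T.
  apply: (@le_lt_trans _ _ (C%:R * N ^+ m.+1)).
    by rewrite /rho -natrX -natrM ler_nat.
  apply: (@le_lt_trans _ _ (N * (q * N ^+ m))).
    rewrite exprS mulrCA ler_wpM2l ?(ltW N_gt0) // ler_wpM2r ?C_leq //.
    by rewrite exprn_ge0 // ltW.
  apply: (@le_lt_trans _ _ (N * T)).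
    rewrite ler_wpM2l ?(ltW N_gt0) // /T ler_peMr //.
    by rewrite mulr_ge0 ?exprn_ge0 // ltW.
  by rewrite ltr_pM2r.
rewrite energy3_supp.
apply: le_trans (weak_sum_cube (@weak_rep m) T0 rho_lt) _.
rewrite sum_rho.
have ln2 : 0 < ln 2 :> R by rewrite ln_gt0 // ltr1n.
have JlnN : J%:R <= 2 / ln 2 * ln N :> R.
  rewrite mulrAC ler_pdivlMr //.
  have : (trunc_log 2 #|` A|)%:R * ln 2 <= ln N :> R.
    rewrite mulr_natl -lnXn // ler_ln ?posrE ?exprn_gt0 //.
    by rewrite -natrX ler_nat trunc_logP // ltnW.
  have : 1 <= (trunc_log 2 #|` A|)%:R :> R.
    by rewrite ler1n trunc_log_gt0.
  by rewrite /J -natr1; nra.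
set D := q ^+ 2 * N ^+ (2 * m).+1 * y m ^+ 2.
have -> : T ^+ 2 * N ^+ m.+3 = N ^+ m.+2 * D.
  rewrite /T /D (_ : (2 * m).+1 = (m + m).+1)%N; last by lia.
  by rewrite !exprS exprD; ring.
have ND0 : 0 <= N ^+ m.+2 * D.
  have h (x : R) j : 0 < x -> 0 <= x ^+ j by move=> x0; rewrite exprn_ge0 // ltW.
  by rewrite mulr_ge0 ?h //; rewrite mulr_ge0 ?h //; rewrite mulr_ge0 ?h.
apply: (@le_trans _ _ (N ^+ m.+2 * D * (q * J%:R))).
  have -> : q * J%:R = J%:R + 8 * K%:R * J%:R by rewrite /q /growth; ring.
  rewrite mulrDr; apply: lerD; first by rewrite ler_peMr // ler1n.
  have -> : 8 * (K%:R * N ^+ m.+2 * (energy2 psi A m.+2)%:R) * J%:R =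
      N ^+ m.+2 * (energy2 psi A m.+2)%:R * (8 * K%:R * J%:R) by ring.
  rewrite ler_wpM2r ?mulr_ge0 // ler_wpM2l ?energy2_le //.
  by rewrite exprn_ge0 // ltW.
apply: (@le_trans _ _ (N ^+ m.+2 * D * (q * (2 / ln 2 * ln N)))).
  by rewrite ler_wpM2l // ler_wpM2l // ltW.
rewrite /D (_ : (3 * m.+1 = m.+2 + (2 * m).+1)%N); last by lia.
by rewrite exprD le_eqVlt; apply/orP; left; apply/eqP; ring.
Qed.
End Bounds.
End Curve.

Theorem theorem2p2 (R : realType) (C : R) (hC : 0 < C) :
  exists K : R, 0 < K /\
    forall (I : set R) (psi : R -> R),
      is_interval I ->
      {within I, continuous psi} ->
      (forall d1 d2 : R, d1 != 0 ->
         card_at_most (difference_pairs I psi d1 d2) C) ->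
      (forall n1 n2 : R, card_at_most (sum_pairs I psi n1 n2) C) ->
      forall (A : {fset R}) (s : nat),
        [set` A] `<=` I ->
        (2 <= #|` A|)%N ->
        (3 <= s)%N ->
        `| energy3 psi A s | <=
          K * `| (#|` A|)%:R `^ (3 * s%:R - 6 + 2 `^ (- s%:R + 3))
                 * ln (#|` A|)%:R |.
Proof.
pose n := Num.bound C.
have Cn : C < n%:R by apply: archi_boundP; exact: ltW.
have n0 : (0 < n)%N by rewrite -(ltr_nat R); exact: lt_trans Cn.
have bound_n (S : set (R * R)) : card_at_most S C -> card_at_most S (n%:R : R).
  by case=> finS cardS; split=> //; exact: le_trans cardS (ltW Cn).
have ln2 : 0 < ln 2 :> R by rewrite ln_gt0 // ltr1n.
exists (2 * growth R n ^+ 3 / ln 2); split.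
  by rewrite divr_gt0 // mulr_gt0 // exprn_gt0 // /growth ltr_pwDl // mulr_ge0.
move=> I psi I_itv psi_cont hd hs A s AI A_gt1 s3.
have {s3} [m ->] : exists m, s = m.+3 by exists (s - 3)%N; lia.
have N0 : 0 < (#|` A|)%:R :> R by rewrite ltr0n ltnW.
have lnN : 0 <= ln (#|` A|)%:R :> R by rewrite ln_ge0 // ler1n ltnW.
have energy_ge0 : 0 <= energy3 psi A m.+3.
  by rewrite energy3_supp sumr_ge0 // => u _; rewrite exprn_ge0.
rewrite (ger0_norm energy_ge0) ger0_norm ?mulr_ge0 ?powR_ge0 //.
have -> : 3 * m.+3%:R - 6 + 2 `^ (- m.+3%:R + 3) =
    (3 * m.+1)%:R + 2^-1 ^+ m :> R.
  have -> : - m.+3%:R + 3 = - m%:R :> R by rewrite -[m.+3]addn3 natrD; ring.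
  rewrite powR_invn // exprVn; congr (_ + _).
  by rewrite natrM -[m.+3]addn3 -[m.+1]addn1 !natrD; ring.
rewrite powRD; last by rewrite (gt_eqF N0) implybT.
rewrite powR_mulrn ?(ltW N0) // -root_powE ?(ltW N0) //.
have hd_n d1 d2 (d10 : d1 != 0) := bound_n _ (hd d1 d2 d10).
have hs_n n1 n2 := bound_n _ (hs n1 n2).
exact: (energy3_le I_itv psi_cont hd_n n0 hs_n AI A_gt1 m).
Qed.
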